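(* Let $f=a/d^{\,j}\in\mathbb F(\mathbf x)$ where $j\ge1$, $a\in\mathbb F(x_2,\dots,x_m)[x_1]$, $d\in\mathbb F[\mathbf x]$ is irreducible with $\deg_{x_1}(d)>0$ and $\deg_{x_1}(a)<\deg_{x_1}(d)$. Let $\{\tau_1,\dots,\tau_r\}$ be a basis of the free abelian group $G_d$ (if $G_d=\{\mathbf 1\}$, take $r=1$, $\tau_1=\mathbf 1$ the identity). Then $f$ is $(\sigma_{x_1},\dots,\sigma_{x_n})$-summable in $\mathbb F(\mathbf x)$ if and only if $$a=\Delta_{\tau_1}(b_1)+\cdots+\Delta_{\tau_r}(b_r)$$ for some $b_i\in\mathbb F(x_2,\dots,x_m)[x_1]$ with $\deg_{x_1}(b_i)<\deg_{x_1}(d)$ for all $1\le i\le r$.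
   Context: $\mathbb F$ is a field of characteristic zero, $\mathbf x=(x_1,\dots,x_m)$, $1\le n\le m$. $\sigma_{x_i}$ is the $\mathbb F$-automorphism of $\mathbb F(\mathbf x)$ with $\sigma_{x_i}(x_i)=x_i+1$, fixing the other variables; $G=\langle\sigma_{x_1},\dots,\sigma_{x_n}\rangle$. For $\tau\in G$, $\Delta_\tau(g)=\tau(g)-g$. $f$ is $(\sigma_{x_1},\dots,\sigma_{x_n})$-summable in $\mathbb F(\mathbf x)$ if $f=\sum_{i=1}^n(\sigma_{x_i}(g_i)-g_i)$ for some $g_i\in\mathbb F(\mathbf x)$. The isotropy group of $d$ in $G$ is $G_d=\{\tau\in G:\tau(d)=d\}$. *)

(* Defs.v *)
From HB Require Import structures.
From mathcomp Require Import all_boot all_order all_algebra.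
From mathcomp Require Import fraction generic_quotient.
From mathcomp.multinomials Require Import mpoly.
Set Implicit Arguments. Unset Strict Implicit. Unset Printing Implicit Defensive.
Import Order.TTheory GRing.Theory Num.Theory.
Local Open Scope ring_scope.

(* Variables are x_1..x_m, indexed 0..m-1 ('I_m); x_1 is index 0.
   Elements of the group G = <sigma_{x_1},...,sigma_{x_n}> (free abelian) are
   represented by their exponent vectors k : 'rV[int]_n, acting by
   x_i |-> x_i + k_i for i <= n and fixing x_{n+1},...,x_m. *)

Notation "x %:F" := (@FracField.tofrac _ x) (format "x %:F").

Section Defs.
Variables (F : fieldType) (m n : nat).

Notation P := {mpoly F[m]}.
Notation Q := {fraction P}.

Definition kat (k : 'rV[int]_n) (j : 'I_m) : int :=
  match (insub (val j) : option 'I_n) with Some i => k 0 i | None => 0 end.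

Definition shiftp (k : 'rV[int]_n) (p : P) : P :=
  p \mPo [tuple ('X_j + ((kat k j)%:~R)%:MP : P) | j < m].

Definition shiftf (k : 'rV[int]_n) (x : Q) : Q :=
  let r := repr x in (shiftp k (frac r).1)%:F / (shiftp k (frac r).2)%:F.

Definition Delta (k : 'rV[int]_n) (x : Q) : Q := shiftf k x - x.

Definition sigma (i : 'I_n) : Q -> Q := shiftf (delta_mx 0 i).

Definition summable (f : Q) : Prop :=
  exists g : 'I_n -> Q, f = \sum_(i < n) (sigma i (g i) - g i).

Definition degv (i : nat) (p : P) : nat :=
  \max_(mo <- msupp p) \max_(j < m | val j == i) mo j.

(* a \in F(x_2,...,x_m)[x_1] with deg_{x_1}(a) < k *)
Definition polyx1_lt (k : nat) (a : Q) : Prop :=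
  exists p q : P, [/\ q != 0, degv 0 q = 0%N, (degv 0 p < k)%N & a = p%:F / q%:F].

Definition mirreducible (d : P) : Prop :=
  d != 0 /\ d \isn't a GRing.unit /\
  forall p q : P, d = p * q -> p \is a GRing.unit \/ q \is a GRing.unit.

Definition inGd (d : P) (k : 'rV[int]_n) : Prop := shiftf k d%:F = d%:F.

Definition is_basis_Gd (d : P) (r : nat) (tau : 'I_r -> 'rV[int]_n) : Prop :=
  (forall k, inGd d k <-> exists c : 'I_r -> int, k = \sum_(i < r) (tau i) *~ (c i)) /\
  (forall c : 'I_r -> int, \sum_(i < r) (tau i) *~ (c i) = 0 -> forall i, c i = 0).

Definition chosen_basis_Gd (d : P) (r : nat) (tau : 'I_r -> 'rV[int]_n) : Prop :=
  ((exists k, inGd d k /\ k != 0) /\ is_basis_Gd d tau) \/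
  ((forall k, inGd d k -> k = 0) /\ r = 1%N /\ forall i, tau i = 0).

End Defs.

(* Main.v *)
(* In the coordinate x_1 every rational function has a d-adic expansion with coefficients
   of degree less than deg_{x_1} d; the coefficient of d^-j is an additive map that commutes
   with the isotropy group G_d.  Evaluating it on the G-translates of g, one for each coset
   of G_d (only finitely many contribute, since only finitely many translates of d divide
   the denominator), and adding up gives a map that is G-invariant modulo the span of the
   Delta_{tau_i}(b_i), hence kills every summable function modulo that span.  It sends
   a/d^j to a, because a translate of d which d divides is d itself.  Irreducibility in
   F[x] is turned into primality by Gauss's lemma. *)

Require Import Defs.
From HB Require Import structures.
From mathcomp Require Import all_boot all_order all_algebra.
From mathcomp Require Import fraction generic_quotient.
From mathcomp.multinomials Require Import mpoly.
From mathcomp Require Import ring.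
From Stdlib Require Import Classical ClassicalEpsilon.
Import Order.TTheory GRing.Theory Num.Theory.
Local Open Scope ring_scope.
Set Implicit Arguments. Unset Strict Implicit. Unset Printing Implicit Defensive.

(** The ring F(x_2,...,x_m)[x_1] is never built: all computations take place in F[x] and its
    fraction field. A nonzero polynomial free of x_1 is not divisible by [d], so it is invertible in
    the localization of F[x] at (d), which is [regular]; primality of [d] makes this localization a
    ring. Numerators of degree less than deg_{x_1} d represent its residue field, and the fraction
    field is the direct sum of [polar], of these numerators and of [d] times [regular]. The middle
    summand carries the coefficient of d^0; the coefficient of d^-j is reached by multiplying by d^j
    first, which commutes with G_d. The converse needs no expansion: each tau_i fixes [d], so
    division by d^j commutes with Delta_{tau_i}, and a difference along any lattice vector
    telescopes into differences along the sigma_{x_i}. *)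

(** * Primes and factorization in integral domains *)

Section Divisibility.
Variable R : idomainType.
Implicit Types (x y z p u : R) (s : seq R).

Definition divides x y := exists z, y = x * z.

Definition prime_elt p := [/\ p != 0, p \isn't a GRing.unit
  & forall x y, divides p (x * y) -> divides p x \/ divides p y].

(** Factors are required to be prime rather than irreducible, so that uniqueness of factorization
    comes for free. *)
Definition factored x := exists u s, [/\ u \is a GRing.unit,
  {in s, forall p, prime_elt p} & x = u * \prod_(p <- s) p].

Lemma divides_mull x y z : divides x y -> divides x (z * y).
Proof. by case=> t ->; exists (z * t); rewrite mulrCA. Qed.

Lemma divides_mulr x y z : divides x y -> divides x (y * z).
Proof. by rewrite mulrC; apply: divides_mull. Qed.

Lemma dividesD x y z : divides x y -> divides x z -> divides x (y + z).
Proof. by move=> [t ->] [t' ->]; exists (t + t'); rewrite mulrDr. Qed.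

Lemma divides_unit p u : divides p u -> u \is a GRing.unit -> p \is a GRing.unit.
Proof. by case=> z ->; rewrite unitrM => /andP[]. Qed.

Lemma prime_divides_prod p s : prime_elt p -> divides p (\prod_(q <- s) q) ->
  exists2 q, q \in s & divides p q.
Proof.
move=> [p0 pU pM]; elim: s => [|q s IHs]; rewrite ?big_nil ?big_cons.
  by move=> /divides_unit /(_ (unitr1 _)) /(negP pU).
case/pM => [pq|/IHs[q' q's pq']]; first by exists q; rewrite ?mem_head.
by exists q'; rewrite // inE q's orbT.
Qed.

Lemma prime_divides_prime p q : prime_elt p -> prime_elt q -> divides p q ->
  exists2 u, u \is a GRing.unit & q = u * p.
Proof.
move=> [p0 pU pM] [q0 qU qM] [z Dq].
have [[t Dp]|[t Dz]] : divides q p \/ divides q z.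
- by apply: qM; exists 1; rewrite mulr1.
- exists z; last by rewrite mulrC.
  apply/unitrPr; exists t; apply: (mulfI p0).
  by rewrite mulrA -Dq mulr1.
- case/negP: pU; apply/unitrPr; exists t; apply: (mulfI q0).
  by rewrite mulr1 {2}Dq Dz; ring.
Qed.

Lemma factored_unit u : u \is a GRing.unit -> factored u.
Proof. by exists u, [::]; split=> //; rewrite big_nil mulr1. Qed.

Lemma factored_prime p : prime_elt p -> factored p.
Proof.
move=> pp; exists 1, [:: p]; split; rewrite ?unitr1 ?big_seq1 ?mul1r //.
by move=> q; rewrite inE => /eqP->.
Qed.

Lemma factoredM x y : factored x -> factored y -> factored (x * y).
Proof.
move=> [u [s [uU sP ->]]] [v [t [vU tP ->]]].
exists (u * v), (s ++ t); split; rewrite ?unitrM ?uU ?big_cat //=; last by ring.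
by move=> p; rewrite mem_cat => /orP[/sP|/tP].
Qed.

End Divisibility.

Definition factorial_ring (R : idomainType) := forall x : R, x != 0 -> factored x.

(** Irreducibility forces the cofactor of any prime factor of [d] to be a unit, so [d] is associated
    to a prime. *)
Lemma factorial_irreducible_prime (R : idomainType) (d : R) : factorial_ring R ->
  d != 0 -> d \isn't a GRing.unit ->
  (forall p q, d = p * q -> p \is a GRing.unit \/ q \is a GRing.unit) ->
  prime_elt d.
Proof.
move=> facR d0 dU dirr; split=> //.
have [u [[|p s] [uU sP Dd]]] := facR d d0.
  by case/negP: dU; rewrite Dd big_nil mulr1.
have [p0 pU pM] : prime_elt p by apply: sP; rewrite mem_head.
move: Dd; rewrite big_cons mulrCA => Dd.
have [/(negP pU)//|vU] := dirr _ _ Dd.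
move=> x y [z Dxy].
have dividesdp w : divides p w -> divides d w.
  move=> [t ->]; exists ((u * \prod_(q <- s) q)^-1 * t).
  by rewrite mulrA Dd mulrK.
have [] : divides p x \/ divides p y.
- by apply: pM; rewrite Dxy Dd -mulrA; exists (u * \prod_(j <- s) j * z).
- by move/dividesdp; left.
- by move/dividesdp; right.
Qed.

Section Transfer.
Variables (R S : idomainType) (f : {rmorphism R -> S}) (g : S -> R).
Hypotheses (fK : cancel f g) (gK : cancel g f).

Lemma iso_unit x : (f x \is a GRing.unit) = (x \is a GRing.unit).
Proof.
apply/idP/idP; last exact: rmorph_unit.
case/unitrPr=> y fxy; apply/unitrPr; exists (g y); apply: (can_inj fK).
by rewrite rmorphM gK rmorph1.
Qed.

Lemma iso_divides x y : divides (f x) (f y) <-> divides x y.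
Proof.
split=> [[z Dz]|[z ->]]; last by exists (f z); rewrite rmorphM.
by exists (g z); apply: (can_inj fK); rewrite Dz rmorphM gK.
Qed.

Lemma iso_prime x : prime_elt (f x) -> prime_elt x.
Proof.
case=> x0 xU xM; split.
- by apply: contraNneq x0 => ->; rewrite rmorph0.
- by rewrite -iso_unit.
by move=> a b /iso_divides; rewrite rmorphM => /xM[/iso_divides|/iso_divides]; auto.
Qed.

Lemma factorial_iso : factorial_ring S -> factorial_ring R.
Proof.
move=> facS x x0; have fx0 : f x != 0.
  by rewrite -(rmorph0 f) (inj_eq (can_inj fK)).
have [u [s [uU sP Df]]] := facS _ fx0.
exists (g u), (map g s); split.
- by rewrite -iso_unit gK.
- by move=> _ /mapP[q qs ->]; apply: iso_prime; rewrite gK; apply: sP.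
apply: (can_inj fK); rewrite Df rmorphM gK rmorph_prod big_map.
by congr (_ * _); apply: eq_bigr => i _; rewrite gK.
Qed.
End Transfer.

(** * Gauss's lemma: factoriality passes from R to R[X] *)

Section Gauss.
Variable R : idomainType.
Implicit Types (f g h : {poly R}) (p c : R).

Lemma divides_polyCP p f : divides p%:P f <-> forall i, divides p f`_i.
Proof.
split=> [[g ->] i|pf]; first by exists g`_i; rewrite coefCM.
have [e De] : exists e : nat -> R, forall i, f`_i = p * e i.
  exists (fun i => proj1_sig (constructive_indefinite_description _ (pf i))) => i.
  by case: constructive_indefinite_description.
exists (\poly_(i < size f) e i); apply/polyP=> i.
rewrite coefCM coef_poly; case: ltnP => [_|/leq_sizeP -> //]; first exact: De.
by rewrite mulr0.
Qed.

Lemma divides_polyC_lead p f : divides p%:P f -> divides p (lead_coef f).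
Proof. by move/divides_polyCP; apply. Qed.

(** If [p] divides f g, it divides the product of the leading coefficients, hence one of them.
    Removing that leading term, itself a multiple of [p], lowers the total size and keeps the
    divisibility. *)
Lemma prime_polyC p : prime_elt p -> prime_elt p%:P.
Proof.
move=> [p0 pU pM]; split; first by rewrite polyC_eq0.
  by rewrite poly_unitE coefC eqxx negb_and pU orbT.
have low f : f != 0 -> (size (f - lead_coef f *: 'X^((size f).-1))%R < size f)%N.
  move=> f0; rewrite -[ltnRHS]prednK ?size_poly_gt0 // ltnS.
  apply/leq_sizeP => i; rewrite coefB coefZ coefXn leq_eqVlt => /orP[/eqP<-|ltfi].
    by rewrite eqxx mulr1 lead_coefE subrr.
  rewrite (gtn_eqF ltfi) mulr0 subr0 nth_default //.
  by rewrite -ltnS -[X in (X < _)%N]prednK ?size_poly_gt0.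
have divl c k : divides p c -> divides p%:P (c *: 'X^k).
  by move=> [z ->]; exists (z *: 'X^k); rewrite mul_polyC scalerA.
move=> f g; move: {2}_.+1 (ltnSn (size f + size g)) => n.
elim: n f g => // n IHn f g; rewrite ltnS => le_n pfg.
have [->|f0] := eqVneq f 0; first by left; exists 0; rewrite mulr0.
have [->|g0] := eqVneq g 0; first by right; exists 0; rewrite mulr0.
have [z Dfg] := pfg.
have plead : divides p (lead_coef f * lead_coef g).
  by rewrite -lead_coefM; apply: divides_polyC_lead.
have [pl|pl] := pM _ _ plead.
- have pt := divl _ (size f).-1 pl.
  have [||/(fun H => dividesD H pt)|] := IHn (f - lead_coef f *: 'X^((size f).-1)) g.
  + by rewrite (leq_trans _ le_n) // ltn_add2r low.
  + rewrite mulrBl -mulN1r; apply: dividesD => //.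
    exact/divides_mull/divides_mulr.
  + by rewrite subrK; left.
  + by right.
- have pt := divl _ (size g).-1 pl.
  have [|||/(fun H => dividesD H pt)] := IHn f (g - lead_coef g *: 'X^((size g).-1)).
  + by rewrite (leq_trans _ le_n) // ltn_add2l low.
  + rewrite mulrBr -mulN1r; apply: dividesD => //.
    exact/divides_mull/divides_mull.
  + by left.
  + by rewrite subrK; right.
Qed.

Lemma factored_polyC c : factored c -> factored c%:P.
Proof.
move=> [u [s [uU sP ->]]]; exists u%:P, (map polyC s); split.
- exact: rmorph_unit.
- by move=> _ /mapP[q /sP qP ->]; apply: prime_polyC.
- by rewrite polyCM rmorph_prod big_map.
Qed.

(** This brings a factorization over the fraction field back to R[X]: the primes of [c] are
    cancelled one at a time, each dividing [g] or [h] because it stays prime in R[X]. *)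
Lemma scale_mul_split c f g h : factored c -> c != 0 -> c *: f = g * h ->
  exists c1 c2 g' h',
    [/\ c1 != 0, c2 != 0, g = c1 *: g', h = c2 *: h' & f = g' * h'].
Proof.
move=> [u [s [uU sP ->]]] _; elim: s => [|p s IHs] in sP g h *.
  rewrite big_nil mulr1 => Df; exists u, 1, (u^-1 *: g), h.
  rewrite scalerA divrr // !scale1r oner_neq0 -scalerAl -Df scalerA mulVr //.
  by rewrite scale1r; split=> //; apply: contraTneq uU => ->; rewrite unitr0.
have sP' : {in s, forall q, prime_elt q} by move=> q qs; apply: sP; rewrite inE qs orbT.
have pP : prime_elt p by apply: sP; rewrite mem_head.
have [p0 _ _] := pP; have [pX0 _ pXM] := prime_polyC pP.
rewrite big_cons mulrCA -scalerA -mul_polyC => Df.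
have [[g1 Dg]|[h1 Dh]] := pXM g h (ex_intro _ _ (esym Df)).
- move: Df; rewrite Dg -mulrA => /(mulfI pX0) /(IHs sP').
  move=> [c1 [c2 [g' [h' [c1n0 c2n0 -> -> ->]]]]].
  exists (p * c1), c2, g', h'; rewrite mulf_neq0 //; split=> //.
  by rewrite mul_polyC scalerA.
- move: Df; rewrite Dh mulrCA => /(mulfI pX0) /(IHs sP').
  move=> [c1 [c2 [g' [h' [c1n0 c2n0 -> -> ->]]]]].
  exists c1, (p * c2), g', h'; rewrite mulf_neq0 //; split=> //.
  by rewrite mul_polyC scalerA.
Qed.

Definition primitive f := forall p, prime_elt p -> ~ divides p%:P f.

Lemma primitive_scale_unit c f g : factored c -> primitive f -> f = c *: g ->
  c \is a GRing.unit.
Proof.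
move=> [u [[|p s] [uU sP ->]]] prf Df; first by rewrite big_nil mulr1.
case: (prf p); first by apply: sP; rewrite mem_head.
by exists ((u * \prod_(q <- s) q) *: g); rewrite Df mul_polyC scalerA big_cons mulrCA.
Qed.

Hypothesis facR : factorial_ring R.

(** Extracting a prime constant from [f] removes an associate of it from the factorization of the
    leading coefficient, so the extraction stops. *)
Lemma primitive_part f : f != 0 ->
  exists c g, [/\ c != 0, primitive g & f = c *: g].
Proof.
move=> f0; have [|u [s [uU sP]]] := facR (x := lead_coef f); first by rewrite lead_coef_eq0.
move: {2}_.+1 (ltnSn (size s)) => n.
elim: n f f0 u s uU sP => // n IHn f f0 u s uU sP; rewrite ltnS => le_s Df.
have [[p [pP pf]]|prim_f] := classic (exists p, prime_elt p /\ divides p%:P f);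
    last first.
  exists 1, f; rewrite oner_neq0 scale1r; split=> // p pP pf.
  by apply: prim_f; exists p.
have [p0 pU pM] := pP.
have [q qs [v vU Dq]] : exists2 q, q \in s & exists2 v, v \is a GRing.unit & q = v * p.
  have := divides_polyC_lead pf; rewrite Df => /pM[/divides_unit /(_ uU)|].
    by move/(negP pU).
  by case/(prime_divides_prod pP) => q qs /(prime_divides_prime pP (sP q qs)); exists q.
have [g Dg] := pf; have g0 : g != 0 by apply: contraNneq f0 => g0; rewrite Dg g0 mulr0.
have [|q' /mem_rem/sP //|||c [h [c0 prim_h Dh]]] := IHn g g0 (u * v) (rem q s).
- by rewrite unitrM uU.
- by rewrite size_rem // (leq_trans _ le_s) // prednK // -has_predT; apply/hasP; exists q.
- move: Df; rewrite Dg lead_coefM lead_coefC (perm_big _ (perm_to_rem qs)) big_cons.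
  by rewrite /= {1}Dq => Df; apply: (mulfI p0); rewrite Df; ring.
- by exists (p * c), h; rewrite mulf_neq0 // -scalerA -Dh Dg mul_polyC.
Qed.

Lemma primitive_irreducible_prime f : primitive f -> irreducible_poly f ->
  prime_elt f.
Proof.
move=> prim_f irr_f; have f0 := irredp_neq0 irr_f.
(* Over a domain [%|] is divisibility up to a nonzero scalar; a primitive [f] can only absorb a unit
   part of that scalar. *)
have strip g : f %| g -> divides f g.
  case/Pdiv.WeakIdomain.dvdpP => -[c q] /= c0 /(scale_mul_split (facR c0) c0).
  move=> [c1 [c2 [q' [f' [c1n0 c2n0 _ Df ->]]]]].
  have c2U := primitive_scale_unit (facR c2n0) prim_f Df.
  exists (c2^-1 *: q'); rewrite Df -scalerAl -scalerAr scalerA mulrV //.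
  by rewrite scale1r mulrC.
split=> //.
  by have [f1 _] := irr_f; rewrite poly_unitE (gtn_eqF f1).
move=> g h [k Dgh].
have fgh : f %| g * h by rewrite Dgh dvdp_mulr.
have [cop|ncop] := boolP (coprimep f g).
  by right; apply: strip; rewrite -(Gauss_dvdpr _ cop).
left; apply: strip; have fgf : gcdp f g %= f.
  by apply: (irr_f : forall q, _); rewrite ?dvdp_gcdl.
by rewrite -(eqp_dvdl _ fgf) dvdp_gcdr.
Qed.

Theorem factorial_poly : factorial_ring {poly R}.
Proof.
move=> f; move: {2}_.+1 (ltnSn (size f)) => n.
elim: n f => // n IHn f; rewrite ltnS => le_f f0.
have [c [g [c0 prim_g Df]]] := primitive_part f0.
have szf : size f = size g by rewrite Df size_scale.
have g0 : g != 0 by rewrite -size_poly_gt0 -szf size_poly_gt0.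
rewrite Df -mul_polyC; apply: factoredM; first exact/factored_polyC/facR.
have [g1|g1] := leqP (size g) 1.
  by rewrite (size1_polyC g1) in g0 *; apply/factored_polyC/facR; rewrite -polyC_eq0.
have [irr_g|red_g] := classic (irreducible_poly g).
  exact/factored_prime/primitive_irreducible_prime.
have [q q1 [qg nqg]] : exists2 q : {poly R}, size q != 1 & q %| g /\ ~~ (q %= g).
  apply: NNPP => nq; apply: red_g; split=> // q q1 qg.
  by apply/negPn/negP => nqg; apply: nq; exists q.
have [[c' k] /= c'0 Dg] := Pdiv.WeakIdomain.dvdpP _ _ qg.
(* A constant cofactor would make [q] associated to [g], against the choice of [q]. *)
have k1 : size k != 1.
  apply: contra nqg => /size_poly1P[b b0 Dk]; apply/eqpP; exists (b, c') => /=.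
    by rewrite b0 c'0.
  by rewrite Dg Dk mul_polyC.
have [c1 [c2 [k' [q' [c1n0 c2n0 Dk Dq Dg']]]]] := scale_mul_split (facR c'0) c'0 Dg.
rewrite Dk size_scale // in k1; rewrite Dq size_scale // in q1.
have [k'0 q'0] : k' != 0 /\ q' != 0 by apply/andP; rewrite -negb_or -mulf_eq0 -Dg'.
have sz : (size k' + size q' = (size g).+1)%N.
  by rewrite Dg' size_mul // prednK // addn_gt0 size_poly_gt0 k'0.
have [k'p q'p] : (0 < size k')%N /\ (0 < size q')%N by rewrite !size_poly_gt0.
(* Both factors now have size at least 2, and their sizes add up to one more than that of [g], so
   each is smaller than [f]. *)
move: k1 q1 k'p q'p sz.
case: (size k') (IHn k') => [|[|sk]] // IHk; case: (size q') (IHn q') => [|[|sq]] // IHq.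
move=> _ _ _ _ []; rewrite -szf => sz; rewrite Dg'; apply: factoredM.
  by apply: IHk => //; rewrite (leq_trans _ le_f) // -sz !addnS !ltnS leq_addr.
by apply: IHq => //; rewrite (leq_trans _ le_f) // -sz !addSn ltnS leq_addl.
Qed.

End Gauss.

(** * Factoriality of multivariate polynomial rings *)

Section MPoly.
Variable F : fieldType.

(** Identities between substitutions are proved below by presenting both sides as ring morphisms and
    comparing them on generators. *)
Lemma mpoly_morph_ext (n : nat) (S : comNzRingType) (f g : {rmorphism {mpoly F[n]} -> S}) :
  (forall c, f c%:MP = g c%:MP) -> (forall i, f 'X_i = g 'X_i) -> f =1 g.
Proof.
move=> fgC fgX p; rewrite [p]mpolyE !raddf_sum; apply: eq_bigr => m _ /=.
rewrite -mul_mpolyC !rmorphM /= fgC mpolyXE_id !rmorph_prod; congr (_ * _).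
by apply: eq_bigr => i _; rewrite !rmorphXn fgX.
Qed.


Lemma muniX (n : nat) (i : 'I_n.+1) : muni ('X_i : {mpoly F[n.+1]}) =
  if unlift ord_max i is Some k then ('X_k)%:P else 'X.
Proof.
rewrite /muni mmapX mmap1U; case: splitP => k /= Dk; case: unliftP => [l|] Di //.
- by congr (('X__)%:P); apply/val_inj; rewrite -[LHS]Dk Di lift_max.
- by have := ltn_ord k; rewrite -Dk Di ltnn.
by have := ltn_ord l; rewrite -[X in (X < _)%N](lift_max l) -Di Dk ltnNge leq_addr.
Qed.

Lemma muni_mwiden (n : nat) (p : {mpoly F[n]}) : muni (mwiden p) = p%:P.
Proof.
move: p; apply: (@mpoly_morph_ext _ _ (@muni n F \o @mwiden n F) polyC) => [c|i] /=.
  by rewrite mwidenC muniC.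
rewrite mwidenX; have -> : mnmwiden U_(i) = U_(lift ord_max i)%MM.
  by rewrite mnmwiden1; congr U_(_)%MM; apply: val_inj; exact/esym/lift_max.
by rewrite muniX liftK.
Qed.

Lemma factorial_mpoly (n : nat) : factorial_ring {mpoly F[n]}.
Proof.
elim: n => [|n IHn].
  move=> p p0; apply: factored_unit; rewrite [p]nvar0_mpolyC in p0 *.
  by rewrite rmorph_unit // unitfE; apply: contraNneq p0 => ->.
(* The inverse of [muni], which isolates the last variable: re-embed the coefficients and substitute
   that variable. *)
pose g (p : {poly {mpoly F[n]}}) : {mpoly F[n.+1]} := (map_poly (@mwiden n F) p).['X_ord_max].
apply: (@factorial_iso _ _ (@muni n F) g) (factorial_poly IHn) => [p|p]; last first.
  rewrite /g -horner_map /= muniX unlift_none -map_poly_comp.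
  rewrite (eq_map_poly (g := polyC)) => [|c]; last exact: muni_mwiden.
  exact: comp_polyXr.
move: p; apply: (@mpoly_morph_ext _ _
  (horner_eval 'X_ord_max \o map_poly (@mwiden n F) \o @muni n F) idfun) => [c|i] /=.
  by rewrite muniC map_polyC /= mwidenC horner_evalE hornerC.
rewrite muniX; case: unliftP => [k ->|->].
  rewrite map_polyC /= horner_evalE hornerC mwidenX mnmwiden1.
  by congr 'X_[U_(_)%MM]; apply: val_inj; exact/esym/lift_max.
by rewrite map_polyX horner_evalE hornerX.
Qed.

Lemma mirreducible_prime (n : nat) (d : {mpoly F[n]}) : mirreducible d -> prime_elt d.
Proof.
by case=> d0 [dU dirr]; apply: factorial_irreducible_prime => //; apply: factorial_mpoly.
Qed.

End MPoly.

(** * Polynomials viewed in the variable x_1 *)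

Section MainVariable.
Variables (F : fieldType) (m : nat).
Notation P := {mpoly F[m.+1]}.
Implicit Types (p q c d : P) (mo : 'X_{1..m.+1}).
Notation deg1 := (@degv F m.+1 0).

(** The coefficients are kept in the full ring F[x], so that they multiply polynomials without any
    embedding; [theta_coef] records that they are free of x_1. *)
Definition theta_var (i : 'I_m.+1) : {poly P} := if i == ord0 then 'X else ('X_i)%:P.

(* Opaque on purpose: unfolding [mmap] during unification is prohibitively slow. *)
Fact theta_sig : {f : {rmorphism P -> {poly P}} |
  f =1 mmap (polyC \o @mpolyC m.+1 F) theta_var}.
Proof. by exists (mmap (polyC \o @mpolyC m.+1 F) theta_var). Qed.

Definition theta := sval theta_sig.

Lemma thetaE : theta =1 mmap (polyC \o @mpolyC m.+1 F) theta_var.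
Proof. exact: (svalP theta_sig). Qed.

Lemma thetaC (c : F) : theta c%:MP = (c%:MP)%:P.
Proof. by rewrite thetaE mmapC. Qed.

Lemma thetaX i : theta 'X_i = theta_var i.
Proof. by rewrite thetaE mmapX mmap1U. Qed.

Lemma theta_eval p : (theta p).['X_ord0] = p.
Proof.
move: p; apply: (@mpoly_morph_ext _ _ _ (horner_eval 'X_ord0 \o theta) idfun) => [c|i] /=.
  by rewrite thetaC horner_evalE hornerC.
rewrite thetaX /theta_var horner_evalE; case: eqP => [->|_]; first by rewrite hornerX.
by rewrite hornerC.
Qed.

Lemma theta_inj : injective theta.
Proof. by move=> p q pq; rewrite -(theta_eval p) pq theta_eval. Qed.

Lemma theta_eq0 p : (theta p == 0) = (p == 0).
Proof. by rewrite -(inj_eq theta_inj) rmorph0. Qed.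

Lemma theta_coef p i : theta (theta p)`_i = ((theta p)`_i)%:P.
Proof.
suff tt : map_poly theta (theta p) = map_poly polyC (theta p).
  by rewrite -!coef_map tt.
move: p; apply: (@mpoly_morph_ext _ _ _ (map_poly theta \o theta) (map_poly polyC \o theta))
  => [c|k] /=; first by rewrite thetaC !map_polyC /= thetaC.
rewrite thetaX /theta_var; case: eqP => [_|/eqP k0]; first by rewrite !map_polyX.
by rewrite !map_polyC /= thetaX /theta_var (negPf k0).
Qed.

Let drop0 mo := [multinom (if i == ord0 then 0 else mo i)%N | i < m.+1].

Lemma thetaXm mo : theta 'X_[mo] = 'X_[drop0 mo] *: 'X^(mo ord0).
Proof.
rewrite thetaE mmapX /mmap1 [in RHS]mpolyXE_id !big_ord_recl /= mnmE eqxx mul1r.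
rewrite mulrC -mul_polyC rmorph_prod; congr (_ * _); apply: eq_bigr => i _ /=.
by rewrite mnmE /theta_var /= rmorphXn.
Qed.

Lemma theta_coef_mcoeff p mo : ((theta p)`_(mo ord0))@_(drop0 mo) = p@_mo.
Proof.
rewrite {2}[p]mpolyE thetaE /mmap coef_sum !raddf_sum; apply: eq_bigr => k _ /=.
rewrite -[mmap1 _ _](mmapX _ (polyC \o @mpolyC m.+1 F)) -thetaE thetaXm.
rewrite coefCM coefZ mcoeffCM coefXn mcoeffZ mcoeffX; congr (_ * _).
have [e0|n0] := eqVneq (mo ord0) (k ord0).
  rewrite mulr1 mcoeffX; congr ((nat_of_bool _)%:R); apply/eqP/eqP => [|->//].
  move=> /mnmP dk; apply/mnmP => i; have := dk i; rewrite !mnmE.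
  by case: eqP => // ->.
rewrite mulr0 mcoeff0; case: eqP => // km; by rewrite km eqxx in n0.
Qed.

(** The predecessor gives the zero polynomial degree 0, in agreement with the empty maximum. One
    inequality reads each monomial off a coefficient of [theta p], the other bounds the size of a
    sum of monomials. *)
Lemma degv_theta p : deg1 p = (size (theta p)).-1.
Proof.
have inner mo : (\max_(j < m.+1 | val j == 0%N) mo j)%N = mo ord0.
  rewrite (bigD1 ord0) //= big1 ?maxn0 // => i /andP[/eqP i0] /eqP[].
  exact: val_inj.
rewrite /degv (eq_bigr (fun mo => mo ord0)) => [|mo _]; last exact: inner.
apply/eqP; rewrite eqn_leq; apply/andP; split.
  apply/bigmax_leqP_seq => mo mop _; rewrite mcoeff_msupp in mop.
  suff: (mo ord0 < size (theta p))%N by case: (size _).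
  rewrite ltnNge; apply: contra mop => le_p; rewrite -theta_coef_mcoeff.
  by rewrite nth_default // mcoeff0.
rewrite -subn1 leq_subLR add1n; rewrite thetaE; apply: leq_trans (size_sum _ _ _) _.
apply/bigmax_leqP_seq => mo mop _.
rewrite -[mmap1 _ _](mmapX _ (polyC \o @mpolyC m.+1 F)) -thetaE thetaXm /=.
rewrite mul_polyC; apply: leq_trans (size_scale_leq _ _) _.
apply: leq_trans (size_scale_leq _ _) _; rewrite size_polyXn ltnS.
exact: (@leq_bigmax_seq _ _ _ (fun mo : 'X_{1..m.+1} => mo ord0) mo).
Qed.

Lemma degv_le p k : (deg1 p <= k)%N = (size (theta p) <= k.+1)%N.
Proof. by rewrite degv_theta -subn1 leq_subLR. Qed.

Lemma degv_lt p k : (0 < k)%N -> (deg1 p < k)%N = (size (theta p) <= k)%N.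
Proof. by case: k => // k _; rewrite ltnS degv_le. Qed.

Lemma degvM p q : p != 0 -> q != 0 -> deg1 (p * q) = (deg1 p + deg1 q)%N.
Proof.
rewrite -(theta_eq0 p) -(theta_eq0 q) !degv_theta rmorphM => p0 q0.
rewrite (size_mul p0 q0).
rewrite -(size_poly_gt0 (theta p)) in p0; rewrite -(size_poly_gt0 (theta q)) in q0.
move: p0 q0; case: (size _) => // a; case: (size _) => // b.
by rewrite addnS.
Qed.

Lemma degvM_eq0 p q : deg1 p = 0%N -> deg1 q = 0%N -> deg1 (p * q) = 0%N.
Proof.
have deg0 : deg1 0 = 0%N by rewrite degv_theta rmorph0 size_poly0.
have [->|p0] := eqVneq p 0; first by rewrite mul0r.
have [->|q0] := eqVneq q 0; first by rewrite mulr0.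
by rewrite degvM // => -> ->.
Qed.

Lemma degv1 : deg1 1 = 0%N.
Proof. by rewrite degv_theta rmorph1 size_poly1. Qed.

Lemma degvN p : deg1 (- p) = deg1 p.
Proof. by rewrite !degv_theta rmorphN size_polyN. Qed.

Lemma degvD_lt p q k : (deg1 p < k)%N -> (deg1 q < k)%N -> (deg1 (p + q) < k)%N.
Proof.
case: k => // k; rewrite !ltnS !degv_le rmorphD => pk qk.
by apply: leq_trans (size_polyD _ _) _; rewrite geq_max pk.
Qed.

Lemma degvM_lt p q k : deg1 p = 0%N -> (deg1 q < k)%N -> (deg1 (p * q) < k)%N.
Proof.
have deg0 : deg1 0 = 0%N by rewrite degv_theta rmorph0 size_poly0.
have [->|p0] := eqVneq p 0; first by rewrite mul0r deg0 => _; apply: leq_ltn_trans.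
have [->|q0] := eqVneq q 0; first by rewrite mulr0.
by rewrite degvM // => ->.
Qed.

Lemma degv_coef p i : deg1 (theta p)`_i = 0%N.
Proof. by rewrite degv_theta theta_coef size_polyC; case: eqP. Qed.

Lemma degv_divides_le d p : p != 0 -> divides d p -> (deg1 d <= deg1 p)%N.
Proof.
move=> p0 [z Dp]; rewrite Dp mulf_eq0 negb_or in p0; case/andP: p0 => d0 z0.
by rewrite Dp degvM // leq_addr.
Qed.

Lemma size_cancel_lead (R : idomainType) (f g : {poly R}) : (0 < size g <= size f)%N ->
  (size (lead_coef g *: f - lead_coef f *: ('X^(size f - size g) * g))%R < size f)%N.
Proof.
case/andP => g0 gf; have f0 := leq_trans g0 gf.
rewrite -[ltnRHS](prednK f0) ltnS; apply/leq_sizeP => i.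
rewrite leq_eqVlt => /orP[/eqP<-|ltfi]; rewrite coefB !coefZ coefXnM ltnNge.
  have -> : ((size f - size g) <= (size f).-1)%N.
    by rewrite leq_subLR -(prednK g0) addSn -(prednK f0) ltnS leq_addl.
  have -> : ((size f).-1 - (size f - size g) = (size g).-1)%N.
    apply/eqP; rewrite -(eqn_add2r (size f - size g)) subnK.
      by rewrite -(prednK f0) -(prednK g0) /= subSS addnC subnK // -ltnS !prednK.
    by rewrite leq_subLR -(prednK g0) addSn -(prednK f0) ltnS leq_addl.
  by rewrite /= mulrC subrr.
have fi : (size f <= i)%N by rewrite -(prednK f0).
rewrite nth_default // mulr0 (leq_trans (leq_subr _ _) fi) /=.
rewrite nth_default ?mulr0 ?subr0 //.
by rewrite leq_subRL ?subnK // (leq_trans (leq_subr _ _) fi).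
Qed.

(** The multiplier [c] accumulates powers of the leading coefficient of [d] in x_1; it is free of
    x_1, hence invertible in F(x_2,...,x_m). *)
Lemma pseudo_division d p : (0 < deg1 d)%N -> exists c q r,
  [/\ c != 0, deg1 c = 0%N, (deg1 r < deg1 d)%N & c * p = q * d + r].
Proof.
move=> d1; have d0 : d != 0.
  by apply: contraTneq d1 => ->; rewrite degv_theta rmorph0 size_poly0.
move: {2}_.+1 (ltnSn (deg1 p)) => n; elim: n p => // n IHn p; rewrite ltnS => le_p.
have [lt_pd|le_dp] := ltnP (deg1 p) (deg1 d).
  by exists 1, 0, p; rewrite oner_neq0 degv1 mul1r mul0r add0r.
pose k := (size (theta p) - size (theta d))%N.
pose a := lead_coef (theta d); pose b := lead_coef (theta p).
pose p' := a * p - b * ('X_ord0 ^+ k * d).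
have p1 := leq_trans d1 le_dp.
have szd : size (theta d) = (deg1 d).+1.
  by move: d1; rewrite degv_theta; case: (size _).
have szp : size (theta p) = (deg1 p).+1.
  by move: p1; rewrite degv_theta; case: (size _).
have lt_p' : (deg1 p' < deg1 p)%N.
  rewrite degv_lt // -ltnS -szp /p' !(rmorphB, rmorphM, rmorphXn) /= !theta_coef.
  by rewrite thetaX /theta_var /= !mul_polyC size_cancel_lead // szd szp /= ltnS le_dp.
have [c [q [r [c0 c1 r1 Dr]]]] := IHn p' (leq_trans lt_p' le_p).
exists (c * a), (q + c * (b * 'X_ord0 ^+ k)), r; split=> //.
- by rewrite mulf_neq0 // -(theta_eq0 a) theta_coef polyC_eq0 lead_coef_eq0 theta_eq0.
- exact/degvM_eq0/degv_coef.
- have Dp : a * p = p' + b * ('X_ord0 ^+ k * d) by rewrite subrK.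
  by rewrite -mulrA Dp mulrDr Dr mulrDl addrAC !mulrA.
Qed.

(* The resultant-like [rho] is obtained without leaving polynomials: an element of
   minimal positive degree in the ideal (d, p) would pseudo-divide both d and p. *)
Lemma bezout_main_variable d p : prime_elt d -> (0 < deg1 d)%N -> ~ divides d p ->
  exists s t rho, [/\ rho != 0, deg1 rho = 0%N & s * p + t * d = rho].
Proof.
move=> [d0 dU dM] d1 ndp.
pose ideal h := exists s t, s * p + t * d = h.
have ideal_lin a b g h : ideal g -> ideal h -> ideal (a * g - b * h).
  move=> [s [t <-]] [s' [t' <-]]; exists (a * s - b * s'), (a * t - b * t').
  by ring.
suff descend n : forall h, (deg1 h < n)%N -> h != 0 -> ideal h ->
    exists2 rho, rho != 0 /\ deg1 rho = 0%N & ideal rho.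
  have idd : ideal d by exists 0, 1; rewrite mul0r mul1r add0r.
  have [rho [rho0 rho1] [s [t Drho]]] := descend _ d (ltnSn _) d0 idd.
  by exists s, t, rho.
elim: n => // n IHn h; rewrite ltnS => le_h h0 idh.
have [h1|h1] := posnP (deg1 h); first by exists h.
(* A nonzero remainder modulo [h] is an element of the ideal of smaller degree, to which the
   induction applies. *)
have reduce g : ideal g -> (exists2 rho, rho != 0 /\ deg1 rho = 0%N & ideal rho)
    \/ exists c q, [/\ c != 0, deg1 c = 0%N & c * g = q * h].
  move=> idg; have [c [q [r [c0 c1 r1 Dr]]]] := pseudo_division g h1.
  have [r0|r0] := eqVneq r 0; first by right; exists c, q; rewrite Dr r0 addr0.
  left; apply: (IHn r) => //; first exact: leq_trans r1 le_h.
  have -> : r = c * g - q * h by rewrite Dr; ring.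
  exact: ideal_lin.
have [|//|[c [q [c0 c1 Dd]]]] := reduce d; first by exists 0, 1; rewrite mul0r mul1r add0r.
have [|//|[c' [q' [c'0 c'1 Dp]]]] := reduce p; first by exists 1, 0; rewrite mul0r mul1r addr0.
(* From c d = q h, [d] divides [q] or [h]. In the first case [h] divides [c], which is free of x_1;
   in the second [d] divides c' p, hence [c'], whose degree is too small, or [p]. *)
have [[z Dq]|[z Dh]] : divides d q \/ divides d h.
- by apply: dM; exists c; rewrite -Dd mulrC.
- have Dc : c = z * h by apply: (mulIf d0); rewrite Dd Dq; ring.
  have z0 : z != 0 by apply: contraNneq c0 => z0; rewrite Dc z0 mul0r.
  by move: h1; rewrite -(addKn (deg1 z) (deg1 h)) -degvM // -Dc c1.
- have [[z' Dz']|//] : divides d c' \/ divides d p.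
    by apply: dM; exists (q' * z); rewrite Dp Dh; ring.
  have : divides d c' by exists z'.
  by move/(degv_divides_le c'0); rewrite c'1 leqNgt d1.
Qed.

End MainVariable.
Arguments theta {F m}.

(** * The action of shift vectors on polynomials and fractions *)

Section Shift.
Variables (F : fieldType) (m n : nat).
Notation P := {mpoly F[m]}.
Notation Q := {fraction P}.
Implicit Types (p q d : P) (k l : 'rV[int]_n) (x y : Q).

Lemma kat0 (j : 'I_m) : kat (0 : 'rV[int]_n) j = 0.
Proof. by rewrite /kat; case: insub => // i; rewrite mxE. Qed.

Lemma katD k l (j : 'I_m) : kat (k + l) j = kat k j + kat l j.
Proof. by rewrite /kat; case: insub => // i; rewrite mxE. Qed.

HB.instance Definition _ k := GRing.RMorphism.copy (@shiftp F m n k)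
  (comp_mpoly [tuple ('X_j + ((kat k j)%:~R)%:MP : P) | j < m]).

Lemma shiftpC k (c : F) : shiftp k c%:MP = c%:MP :> P.
Proof. exact: comp_mpolyC. Qed.

Lemma shiftpX k j : shiftp k 'X_j = 'X_j + ((kat k j)%:~R)%:MP :> P.
Proof. by rewrite /shiftp comp_mpolyXU -tnth_nth tnth_map tnth_ord_tuple. Qed.

Lemma shiftp0 p : shiftp (0 : 'rV[int]_n) p = p.
Proof.
move: p; apply: (@mpoly_morph_ext _ _ _ (@shiftp F m n 0) idfun) => [c|j] /=.
  exact: shiftpC.
by rewrite shiftpX kat0 mulr0z mpolyC0 addr0.
Qed.

Lemma shiftp_add k l p : shiftp (k + l) p = shiftp k (shiftp l p).
Proof.
move: p; apply: (@mpoly_morph_ext _ _ _ (@shiftp F m n (k + l))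
  (@shiftp F m n k \o @shiftp F m n l)) => [c|j] /=; first by rewrite !shiftpC.
rewrite !shiftpX rmorphD /= shiftpX shiftpC katD mulrzDr mpolyCD.
by rewrite addrA.
Qed.

Lemma shiftpK k : cancel (@shiftp F m n k) (@shiftp F m n (- k)).
Proof. by move=> p; rewrite -shiftp_add addNr shiftp0. Qed.

Lemma shiftp_inj k : injective (@shiftp F m n k).
Proof. exact: can_inj (@shiftpK k). Qed.

Lemma shiftp_eq0 k p : (shiftp k p == 0) = (p == 0).
Proof. by rewrite -(inj_eq (@shiftp_inj k) p) rmorph0. Qed.

Lemma shiftp_divides k p q : divides p q -> divides (shiftp k p) (shiftp k q).
Proof. by move=> [z ->]; exists (shiftp k z); rewrite rmorphM. Qed.

Lemma msizeM_leq p q a b : (msize p <= a.+1)%N -> (msize q <= b)%N ->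
  (msize (p * q)%R <= a + b)%N.
Proof.
have [->|p0] := eqVneq p 0; first by rewrite mul0r msize0.
have [->|q0] := eqVneq q 0; first by rewrite mulr0 msize0.
move=> pa qb; rewrite msizeM //; have : (msize p + msize q <= a.+1 + b)%N.
  exact: leq_add.
by case: (msize p + msize q)%N.
Qed.

(** The difference of a polynomial and its shift has smaller total degree. This is multiplicative in
    the sense of [T], so it reduces to a single variable, where the difference is a constant. *)
Lemma msize_shiftp_sub k p : (msize (shiftp k p - p)%R <= (msize p).-1)%N.
Proof.
(* As [msize] is the total degree plus one, the second bound is a strict inequality of degrees. *)
pose T (q : P) b := (msize q <= b.+1)%N /\ (msize (shiftp k q - q)%R <= b)%N.
have TM q r a b : T q a -> T r b -> T (q * r) (a + b)%N.
  move=> [q1 q2] [r1 r2]; split; first by rewrite -addnS msizeM_leq.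
  have -> : shiftp k (q * r) - q * r = shiftp k q * (shiftp k r - r) + r * (shiftp k q - q).
    by rewrite rmorphM; ring.
  have sq : (msize (shiftp k q) <= a.+1)%N.
    rewrite -[shiftp k q](subrK q); apply: leq_trans (msizeD_le _ _) _.
    by rewrite geq_max q1 (leq_trans q2).
  apply: leq_trans (msizeD_le _ _) _; rewrite geq_max.
  by rewrite (msizeM_leq sq) //= addnC msizeM_leq.
have T1 : T 1 0%N by split; rewrite ?msize1 // rmorph1 subrr msize0.
have TX mo : T 'X_[mo] (mdeg mo).
  rewrite mpolyXE_id mdegE; apply: (big_ind2 T T1) => [q a r b|j _]; first exact: TM.
  elim: (mo j) => [|e IHe]; rewrite ?expr0 // exprS -[e.+1]add1n; apply: TM IHe.
  split; first by rewrite msizeX mdeg1.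
  rewrite shiftpX addrC addKr msizeC; exact: leq_b1.
rewrite {2}[p]mpolyE {1}[p]mpolyE rmorph_sum -sumrB.
apply: leq_trans (msize_sum _ _ _) _; apply/bigmax_leqP_seq => mo mop _ /=.
rewrite -mul_mpolyC rmorphM /= shiftpC -mulrBr mul_mpolyC.
apply: leq_trans (mmeasureZ_le _ _ _) _; apply: leq_trans (proj2 (TX mo)) _.
by have := msize_mdeg_lt mop; case: (msize p).
Qed.

(* A shift preserves the part of highest total degree, which rules out a nontrivial factor. *)
Lemma shiftp_divides_eq k d : d != 0 -> divides d (shiftp k d) -> shiftp k d = d.
Proof.
move=> d0 [u Du]; have := msize_shiftp_sub k d.
have -> : shiftp k d - d = d * (u - 1) by rewrite Du; ring.
have [u1|u1] := eqVneq u 1; first by rewrite Du u1 mulr1.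
have : u - 1 != 0 by rewrite subr_eq0.
move=> v0; rewrite msizeM //; move: d0 v0; rewrite -!msize_poly_eq0.
case: (msize d) => // a; case: (msize _) => // b _ _.
by rewrite addnS /= addSn ltnNge leq_addr.
Qed.

Lemma pi_frac (R : idomainType) (y : {ratio R}) :
  (\pi_({fraction R})%qT y) * (frac y).2%:F = (frac y).1%:F.
Proof.
unlock FracField.tofrac; rewrite -[LHS]FracField.pi_mul; apply/eqmodP.
rewrite /= FracField.equivfE /FracField.mulf /= !numden_Ratio ?mulf_neq0 ?oner_neq0 ?denom_ratioP //.
by rewrite !mulr1 mulrC.
Qed.

Lemma frac_repr (R : idomainType) (x : {fraction R}) :
  x = (frac (repr x)).1%:F / (frac (repr x)).2%:F.
Proof.
by have := pi_frac (repr x); rewrite reprK => <-; rewrite mulfK // tofrac_eq0 denom_ratioP.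
Qed.

Lemma fractionP (R : idomainType) (x : {fraction R}) :
  exists p q : R, q != 0 /\ x = p%:F / q%:F.
Proof.
by exists (frac (repr x)).1, (frac (repr x)).2; rewrite -frac_repr denom_ratioP.
Qed.

(** [shiftf] works on a chosen representative; [shiftp] preserves cross-multiplied equalities, so
    any other representative gives the same value. *)
Lemma shiftf_frac k p q : q != 0 ->
  shiftf k (p%:F / q%:F) = (shiftp k p)%:F / (shiftp k q)%:F :> Q.
Proof.
move=> q0; rewrite /shiftf; move Dx: (p%:F / q%:F) => x.
have r20 := denom_ratioP (repr x : {ratio P}).
apply/eqP; rewrite eqr_div ?tofrac_eq0 ?shiftp_eq0 //; apply/eqP.
rewrite -!tofracM -!rmorphM /=; congr (_%:F); congr (shiftp _ _).
apply/eqP; rewrite -tofrac_eq !tofracM -eqr_div ?tofrac_eq0 //.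
by rewrite -frac_repr Dx.
Qed.

Lemma shiftf_tofrac k p : shiftf k p%:F = (shiftp k p)%:F :> Q.
Proof.
by rewrite -[p%:F in LHS]divr1 -tofrac1 shiftf_frac ?oner_neq0 // rmorph1 tofrac1 divr1.
Qed.

Lemma shiftf_is_zmod_morphism k : zmod_morphism (@shiftf F m n k).
Proof.
move=> x y; have [p [q [q0 ->]]] := fractionP x; have [r [s [s0 ->]]] := fractionP y.
rewrite -mulNr -tofracN addf_div ?tofrac_eq0 // -!(tofracM, tofracD).
rewrite !shiftf_frac ?mulf_neq0 // -mulNr -tofracN addf_div ?tofrac_eq0 ?shiftp_eq0 //.
by rewrite rmorphD !rmorphM rmorphN /= !(tofracM, tofracD).
Qed.

Lemma shiftf_is_monoid_morphism k : monoid_morphism (@shiftf F m n k).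
Proof.
split; first by rewrite -tofrac1 shiftf_tofrac rmorph1.
move=> x y; have [p [q [q0 ->]]] := fractionP x; have [r [s [s0 ->]]] := fractionP y.
rewrite mulf_div -!tofracM !shiftf_frac ?mulf_neq0 //.
by rewrite mulf_div !rmorphM.
Qed.

HB.instance Definition _ k := GRing.isZmodMorphism.Build Q Q (@shiftf F m n k)
  (shiftf_is_zmod_morphism k).
HB.instance Definition _ k := GRing.isMonoidMorphism.Build Q Q (@shiftf F m n k)
  (shiftf_is_monoid_morphism k).

Lemma shiftf0 x : shiftf (0 : 'rV[int]_n) x = x.
Proof. by have [p [q [q0 ->]]] := fractionP x; rewrite shiftf_frac // !shiftp0. Qed.

Lemma shiftf_add k l x : shiftf (k + l) x = shiftf k (shiftf l x).
Proof.
have [p [q [q0 ->]]] := fractionP x.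
by rewrite [in RHS](shiftf_frac l) // !shiftf_frac ?shiftp_eq0 // !shiftp_add.
Qed.

Lemma inGdP d k : inGd d k <-> shiftp k d = d.
Proof.
rewrite /inGd shiftf_tofrac; split=> [/eqP|->//]; by rewrite tofrac_eq => /eqP.
Qed.

Lemma inGd_opp d k : inGd d k -> inGd d (- k).
Proof. by move/inGdP => dk; apply/inGdP; rewrite -{1}dk shiftpK. Qed.

Lemma inGd_add d k l : inGd d k -> inGd d l -> inGd d (k + l).
Proof. by move=> /inGdP dk /inGdP dl; apply/inGdP; rewrite shiftp_add dl. Qed.

Lemma inGd0 d : inGd d (0 : 'rV[int]_n).
Proof. by apply/inGdP; rewrite shiftp0. Qed.

End Shift.

Section ShiftDegree.
Variables (F : fieldType) (m n : nat).
Notation P := {mpoly F[m.+1]}.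
Implicit Types (p q d : P) (k l : 'rV[int]_n).

(** In terms of [theta], a shift acts injectively on the coefficients and then substitutes x_1 + c
    for x_1; both preserve the size. *)
Lemma degv_shiftp k p : degv 0 (shiftp k p) = degv 0 p.
Proof.
rewrite !degv_theta; pose c : P := ((kat k (ord0 : 'I_m.+1))%:~R)%:MP.
suff -> : theta (shiftp k p) = map_poly (@shiftp F m.+1 n k) (theta p) \Po ('X + c%:P).
  rewrite size_comp_poly2 ?size_XaddC // size_map_inj_poly ?rmorph0 //.
  exact: shiftp_inj.
move: p; apply: (@mpoly_morph_ext _ _ _ (@theta F m \o @shiftp F m.+1 n k)
  (comp_poly ('X + c%:P) \o map_poly (@shiftp F m.+1 n k) \o @theta F m)) => [e|j] /=.
  by rewrite shiftpC thetaC map_polyC /= shiftpC comp_polyC.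
rewrite shiftpX rmorphD /= thetaX thetaC /theta_var; case: eqP => [->|_].
  by rewrite map_polyX comp_polyX.
by rewrite map_polyC /= shiftpX comp_polyC polyCD.
Qed.

End ShiftDegree.

(** * The d-adic coefficient of a rational function *)

(** Here [r] is the Bezout element rho, and [c], [a] are the multiplier and the quotient in the
    pseudo-division of p s by [d]. *)
Lemma bezout_fraction (K : fieldType) (c r q s t d p a : K) :
  c != 0 -> r != 0 -> q != 0 -> r = s * q + t * d ->
  p / q = (c * (p * s) - a * d) / (c * r) + d * (a / (c * r) + p * t / (r * q)).
Proof.
move=> c0 r0 q0 Dr; transitivity (p * (s * q + t * d) / (r * q)).
  by rewrite -Dr; field; rewrite r0 q0.
by field; rewrite c0 r0 q0.
Qed.

Section Residue.
Variables (F : fieldType) (m n : nat).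
Notation P := {mpoly F[m.+1]}.
Notation Q := {fraction P}.
Notation deg1 := (@degv F m.+1 0).
Implicit Types (p q : P) (k h : 'rV[int]_n) (x y w u z : Q).

Lemma degv0 : deg1 0 = 0%N.
Proof. by rewrite degv_theta rmorph0 size_poly0. Qed.

Lemma polyx1_lt0 e : (0 < e)%N -> polyx1_lt e (0 : Q).
Proof.
by exists 0, 1; rewrite oner_neq0 degv1 degv0 tofrac0 mul0r; split.
Qed.

Lemma polyx1_ltN e x : polyx1_lt e x -> polyx1_lt e (- x).
Proof.
move=> [p [q [q0 q1 pe ->]]]; exists (- p), q; split=> //; first by rewrite degvN.
by rewrite tofracN mulNr.
Qed.

Lemma polyx1_ltD e x y : polyx1_lt e x -> polyx1_lt e y -> polyx1_lt e (x + y).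
Proof.
move=> [p [q [q0 q1 pe ->]]] [r [s [s0 s1 re ->]]].
exists (p * s + r * q), (q * s); split; first by rewrite mulf_neq0.
- exact: degvM_eq0.
- by apply: degvD_lt; rewrite mulrC degvM_lt.
- by rewrite addf_div ?tofrac_eq0 // tofracD !tofracM.
Qed.

Lemma polyx1_lt_shiftf e k x : polyx1_lt e x -> polyx1_lt e (shiftf k x).
Proof.
move=> [p [q [q0 q1 pe ->]]]; exists (shiftp k p), (shiftp k q).
by rewrite !degv_shiftp shiftp_eq0 shiftf_frac.
Qed.

Variable d : P.
Hypotheses (dP : prime_elt d) (d1 : (0 < deg1 d)%N).
Notation W := (@polyx1_lt F m.+1 (deg1 d)).

Definition regular x := exists p q, ~ divides d q /\ x = p%:F / q%:F.

Lemma Ndivides_neq0 q : ~ divides d q -> q != 0.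
Proof. by move=> ndq; apply/eqP => q0; apply: ndq; rewrite q0; exists 0; rewrite mulr0. Qed.

Lemma NdividesM p q : ~ divides d p -> ~ divides d q -> ~ divides d (p * q).
Proof. by have [_ _ dM] := dP; move=> ndp ndq /dM[]. Qed.

Lemma Ndivides_degv0 q : q != 0 -> deg1 q = 0%N -> ~ divides d q.
Proof. by move=> q0 q1 /(degv_divides_le q0); rewrite q1 leqNgt d1. Qed.

Lemma regular_tofrac p : regular p%:F.
Proof.
exists p, 1; rewrite tofrac1 divr1; split=> //.
by apply: Ndivides_degv0; rewrite ?oner_neq0 ?degv1.
Qed.

Lemma regularD x y : regular x -> regular y -> regular (x + y).
Proof.
move=> [p [q [dq ->]]] [r [s [ds ->]]]; exists (p * s + r * q), (q * s).
split; first exact: NdividesM.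
by rewrite addf_div ?tofrac_eq0 ?Ndivides_neq0 // tofracD !tofracM.
Qed.

Lemma regularM x y : regular x -> regular y -> regular (x * y).
Proof.
move=> [p [q [dq ->]]] [r [s [ds ->]]]; exists (p * r), (q * s).
by split; [exact: NdividesM | rewrite mulf_div !tofracM].
Qed.

Lemma regularX x e : regular x -> regular (x ^+ e).
Proof.
move=> xR; elim: e => [|e IHe]; first by rewrite expr0 -tofrac1; apply: regular_tofrac.
by rewrite exprS; apply: regularM.
Qed.

Lemma regularN x : regular x -> regular (- x).
Proof. by move=> [p [q [dq ->]]]; exists (- p), q; rewrite tofracN mulNr. Qed.

Lemma regular_polyx1 e x : polyx1_lt e x -> regular x.
Proof. by move=> [p [q [q0 q1 _ ->]]]; exists p, q; split=> //; apply: Ndivides_degv0. Qed.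

Lemma regular_shiftf k x : inGd d k -> regular x -> regular (shiftf k x).
Proof.
move=> Gk [p [q [dq ->]]]; have q0 := Ndivides_neq0 dq.
exists (shiftp k p), (shiftp k q); split; last exact: shiftf_frac.
move=> /(shiftp_divides (- k)); rewrite shiftpK.
by have /inGdP -> := inGd_opp Gk.
Qed.

(** Modulo [d], the Bezout relation inverts the denominator [q] as s / rho; pseudo-division then
    brings the numerator p s below the degree of [d]. *)
Lemma regular_split x : regular x -> exists w u, [/\ W w, regular u & x = w + d%:F * u].
Proof.
move=> [p [q [dq ->]]].
have [s [t [rho [rho0 rho1 Drho]]]] := bezout_main_variable dP d1 dq.
have [c [a [r [c0 c1 r1 Dr]]]] := pseudo_division (p * s) d1.
have q0 := Ndivides_neq0 dq; have cr1 := degvM_eq0 c1 rho1.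
exists (r%:F / (c * rho)%:F), (a%:F / (c * rho)%:F + (p * t)%:F / (rho * q)%:F).
split.
- by exists r, (c * rho); rewrite mulf_neq0.
- apply: regularD; first exists a, (c * rho); last exists (p * t), (rho * q).
    by split=> //; apply: Ndivides_degv0 => //; rewrite mulf_neq0.
  by split=> //; apply: NdividesM => //; apply: Ndivides_degv0.
have cF : c%:F != 0 by rewrite tofrac_eq0.
have rF : rho%:F != 0 by rewrite tofrac_eq0.
have qF : q%:F != 0 by rewrite tofrac_eq0.
have E1 : rho%:F = s%:F * q%:F + t%:F * d%:F by rewrite -!(tofracM, tofracD) Drho.
have E2 : r%:F = c%:F * (p%:F * s%:F) - a%:F * d%:F.
  by rewrite -!(tofracM, tofracB) Dr addrC addKr.
rewrite (tofracM c) (tofracM p t) (tofracM rho).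
rewrite {}E2.
exact: (@bezout_fraction _ _ _ _ _ _ _ _ _ cF rF qF E1).
Qed.

(** By primality [d] would divide the numerator of [w], whose degree in x_1 is too small. *)
Lemma polyx1_lt_dregular w u : W w -> regular u -> w = d%:F * u -> w = 0.
Proof.
move=> [p [q [q0 q1 p1 ->]]] [r [s [ds ->]]]; have s0 := Ndivides_neq0 ds => /eqP.
have [d0 _ dM] := dP.
rewrite mulrA -tofracM eqr_div ?tofrac_eq0 // -!tofracM tofrac_eq => /eqP Dps.
have [|dp|//] := dM p s; first by exists (r * q); rewrite Dps mulrA.
have [->|p0] := eqVneq p 0; first by rewrite tofrac0 mul0r.
by have := degv_divides_le p0 dp; rewrite leqNgt p1.
Qed.

(* Sums of the fractions [w_l / d ^ l] with [l > 0] and [deg w_l < deg d]. *)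
Inductive polar : Q -> Prop :=
| polar0 : polar 0
| polarS x w : polar x -> W w -> polar ((x + w) / d%:F).

Lemma polarD x y : polar x -> polar y -> polar (x + y).
Proof.
move=> xP; elim: xP y => [|x' w xP IHx Ww] y yP; first by rewrite add0r.
case: yP => [|y' w' y'P Ww']; first by rewrite addr0; apply: polarS.
rewrite -mulrDl addrACA; apply: polarS; first exact: IHx.
exact: polyx1_ltD.
Qed.

Lemma polarN x : polar x -> polar (- x).
Proof.
elim=> [|x' w xP IHx Ww]; first by rewrite oppr0; apply: polar0.
by rewrite -mulNr opprD; apply/polarS/polyx1_ltN.
Qed.

Lemma polar_shiftf k x : inGd d k -> polar x -> polar (shiftf k x).
Proof.
move=> Gk; elim=> [|x' w xP IHx Ww]; first by rewrite rmorph0; apply: polar0.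
rewrite fmorph_div /= rmorphD /= Gk; apply: polarS => //.
exact: polyx1_lt_shiftf.
Qed.

Definition residue_spec x w := exists z u,
  [/\ polar z, W w, regular u & x = z + w + d%:F * u].

(** Each extracted factor [d] lowers the degree in x_1, because that of [d] is positive. *)
Lemma denominator_power p : p != 0 -> exists e q, ~ divides d q /\ p = d ^+ e * q.
Proof.
move: {2}_.+1 (ltnSn (deg1 p)) => b; elim: b p => // b IHb p; rewrite ltnS => le_p p0.
have [[p' Dp]|dp] := classic (divides d p); last by exists 0%N, p; rewrite mul1r.
have /andP[d0 p'0] : (d != 0) && (p' != 0) by rewrite -negb_or -mulf_eq0 -Dp.
have [|e [q [dq Dp']]] := IHb p' _ p'0.
  by apply: leq_trans le_p; rewrite Dp degvM // -[X in (X < _)%N]add0n ltn_add2r.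
by exists e.+1, q; rewrite Dp Dp' exprS mulrA.
Qed.

Lemma residue_exists x : exists w, residue_spec x w.
Proof.
have dF : d%:F != 0 by rewrite tofrac_eq0; case: dP.
have [e xe] : exists e, regular (d%:F ^+ e * x).
  have [p [q [q0 ->]]] := fractionP x; have [e [q' [dq' Dq]]] := denominator_power q0.
  exists e, p, q'; split=> //; rewrite Dq tofracM tofracXn mulrA.
  by rewrite -mulf_div divff ?expf_neq0 // mul1r.
elim: e x xe => [|e IHe] x xe.
  rewrite expr0 mul1r in xe; have [w [u [Ww uR Dx]]] := regular_split xe.
  by exists w, 0, u; split=> //; rewrite ?add0r //; apply: polar0.
(* The pole of d x has one order less. Dividing its decomposition by [d] leaves a polar part and a
   regular [u], which is split once more. *)
rewrite exprSr -mulrA in xe; have [w [z [u [zP Ww uR Dx]]]] := IHe _ xe.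
have [w' [u' [Ww' u'R Du]]] := regular_split uR.
exists w', ((z + w) / d%:F), u'; split=> //; first exact: polarS.
by rewrite -addrA -Du; apply: (mulfI dF); rewrite Dx mulrDr mulrCA divff // mulr1.
Qed.

(** Multiplying by [d] shortens the polar part by one term and turns [w] into a regular contribution
    on the right. *)
Lemma polar_regular_eq0 z w u : polar z -> W w -> regular u -> z + w = d%:F * u ->
  z = 0 /\ w = 0.
Proof.
have dF : d%:F != 0 by rewrite tofrac_eq0; case: dP.
move=> zP; elim: zP w u => [|z' w' zP IHz Ww'] w u Ww uR Dw.
  by split=> //; apply: (polyx1_lt_dregular Ww uR); rewrite -Dw add0r.
have [|||z0 w0] := IHz w' (d%:F * u - w) => //.
- apply: regularD; last exact/regularN/(regular_polyx1 Ww).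
  by apply: regularM => //; apply: regular_tofrac.
- by rewrite -Dw addrK mulrCA divff // mulr1.
- rewrite z0 w0 addr0 mul0r in Dw *; split=> //.
  by apply: (polyx1_lt_dregular Ww uR); rewrite -Dw add0r.
Qed.

Definition residue x : Q :=
  proj1_sig (constructive_indefinite_description _ (residue_exists x)).

Lemma residueP x : residue_spec x (residue x).
Proof. by rewrite /residue; case: constructive_indefinite_description. Qed.

Lemma residue_uniq x w : residue_spec x w -> residue x = w.
Proof.
move=> [z [u [zP Ww uR Dx]]]; have [z' [u' [z'P Ww' u'R Dx']]] := residueP x.
have [||||_ /eqP] := @polar_regular_eq0 (z' - z) (residue x - w) (u - u').
- exact/polarD/polarN.
- exact/polyx1_ltD/polyx1_ltN.
- exact/regularD/regularN.
- by rewrite addrACA -opprD mulrBr -[z + w](addrK (d%:F * u)) -Dx {2}Dx'; ring.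
- by rewrite subr_eq0 => /eqP.
Qed.

Lemma residue_polyx1_lt x : W (residue x).
Proof. by have [z [u []]] := residueP x. Qed.

Lemma residueD x y : residue (x + y) = residue x + residue y.
Proof.
have [z [u [zP Ww uR Dx]]] := residueP x; have [z' [u' [z'P Ww' u'R Dy]]] := residueP y.
apply: residue_uniq; exists (z + z'), (u + u'); split.
- exact: polarD.
- exact: polyx1_ltD.
- exact: regularD.
- by rewrite {1}Dx {1}Dy; ring.
Qed.

Lemma residue_shiftf k x : inGd d k -> residue (shiftf k x) = shiftf k (residue x).
Proof.
move=> Gk; have [z [u [zP Ww uR Dx]]] := residueP x.
apply: residue_uniq; exists (shiftf k z), (shiftf k u); split.
- exact: polar_shiftf.
- exact: polyx1_lt_shiftf.
- exact: regular_shiftf.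
- by rewrite {1}Dx !rmorphD rmorphM /= Gk.
Qed.

Lemma residue_dregular u : regular u -> residue (d%:F * u) = 0.
Proof.
move=> uR; apply: residue_uniq; exists 0, u; split; rewrite ?add0r //.
  exact: polar0.
exact: polyx1_lt0.
Qed.

Lemma residue_id w : W w -> residue w = w.
Proof.
move=> Ww; apply: residue_uniq; exists 0, 0; split=> //; first exact: polar0.
  by rewrite -tofrac0; apply: regular_tofrac.
by rewrite mulr0 addr0 add0r.
Qed.

(** If [d] divides the shift of [p] by [h], then [p] has the factor [shiftp (- h) d]. By
    [shiftp_divides_eq] this factor accounts for one coset of G_d only, and removing it lowers the
    degree in x_1. *)
Lemma divides_shiftp_finite p : p != 0 -> exists s : seq 'rV[int]_n,
  forall k, divides d (shiftp k p) -> exists2 h, h \in s & inGd d (k - h).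
Proof.
have [d0 _ dM] := dP.
move: {2}_.+1 (ltnSn (deg1 p)) => b; elim: b p => // b IHb p; rewrite ltnS => le_p p0.
have [[h [p' Dp]]|nh] := classic (exists h, divides d (shiftp h p)); last first.
  by exists [::] => k dk; case: nh; exists k.
have p'0 : p' != 0.
  by apply: contraNneq p0 => p'0; rewrite -(shiftp_eq0 h) Dp p'0 mulr0.
have [||s sP] := IHb (shiftp (- h) p'); last 1 first; last by rewrite shiftp_eq0.
  exists (h :: s) => k; have -> : p = shiftp (- h) d * shiftp (- h) p'.
    by rewrite -rmorphM /= -Dp shiftpK.
  rewrite rmorphM /= => /dM[|/sP[h' h's Gh']]; last by exists h'; rewrite ?inE ?h's ?orbT.
  rewrite -shiftp_add => dk; exists h; rewrite ?mem_head //.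
  exact/inGdP/shiftp_divides_eq.
rewrite degv_shiftp; apply: leq_trans le_p.
by rewrite -(degv_shiftp h p) Dp degvM // -[X in (X < _)%N]add0n ltn_add2r.
Qed.

Lemma regular_shiftf_finite x : exists s : seq 'rV[int]_n,
  forall k, ~ regular (shiftf k x) -> exists2 h, h \in s & inGd d (k - h).
Proof.
have [p [q [q0 ->]]] := fractionP x; have [s sP] := divides_shiftp_finite q0.
exists s => k; rewrite shiftf_frac // => nreg; apply: sP; apply: NNPP => ndk.
by apply: nreg; exists (shiftp k p), (shiftp k q).
Qed.

End Residue.

(** * Sums over cosets and coinvariants *)

Lemma big_uniq_support (V : zmodType) (T : eqType) (f : T -> V) (s t : seq T) :
  uniq s -> uniq t ->
  {in s, forall x, x \notin t -> f x = 0} -> {in t, forall x, x \notin s -> f x = 0} ->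
  \sum_(x <- s) f x = \sum_(x <- t) f x.
Proof.
have nz r : \sum_(x <- r) f x = \sum_(x <- [seq x <- r | f x != 0]) f x.
  rewrite big_filter; apply/esym/big_rmcond_in => x _.
  by rewrite negbK => /eqP.
move=> us ut st ts; rewrite (nz s) (nz t); apply: perm_big; apply: uniq_perm.
- exact: filter_uniq.
- exact: filter_uniq.
move=> x; rewrite !mem_filter; case: eqP => //= fx.
apply/idP/idP => xin; apply/negPn/negP => xout; apply: fx; auto.
Qed.

(* A hands-on form of Shapiro's lemma: [c] extracts the [H]-component of an induced module,
   and summing [c] over [G / H] identifies the coinvariants of [G] with those of [H]. *)
Section OrbitSum.
Variables (G V : zmodType) (act : G -> V -> V) (H : pred G) (I : V -> Prop) (c : V -> V).
Hypotheses (H0 : H 0) (HD : forall a b, H a -> H b -> H (a + b)) (HN : forall a, H a -> H (- a)).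
Hypotheses (I0 : I 0) (ID : forall x y, I x -> I y -> I (x + y)) (IN : forall x, I x -> I (- x)).
Hypotheses (actA : forall a b x, act (a + b) x = act a (act b x))
  (actD : forall a x y, act a (x + y) = act a x + act a y).
Hypotheses (cD : forall x y, c (x + y) = c x + c y)
  (cH : forall a x, H a -> I (c (act a x) - c x))
  (c_finite : forall x, exists s : seq G,
    forall a, c (act a x) <> 0 -> exists2 b, b \in s & H (a - b)).

(** A canonical element of the coset of [a]: [choose] depends only on the extension of the
    predicate, and [a] itself witnesses that it is satisfiable. *)
Let rep (a : G) : G := choose (fun b => H (b - a)) a.

Let rep_in a : H (rep a - a).
Proof. by apply: (@chooseP _ (fun b => H (b - a)) a); rewrite subrr. Qed.

Let rep_eq a b : H (a - b) -> rep a = rep b.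
Proof.
move=> Hab; rewrite /rep (@eq_choose _ _ (fun x => H (x - b))) => [|x].
  by apply: choose_id; rewrite ?subrr.
apply/idP/idP => Hx; first by rewrite -(subrKA a); apply: HD.
by rewrite -(subrKA b); apply: HD; rewrite // -opprB HN.
Qed.

Let rep_rep a : rep (rep a) = rep a.
Proof. exact/rep_eq/rep_in. Qed.

Let carrier x : seq G :=
  undup (map rep (proj1_sig (constructive_indefinite_description _ (c_finite x)))).

Let carrier_rep x : {in carrier x, forall a, rep a = a}.
Proof. by move=> a; rewrite mem_undup => /mapP[b _ ->]. Qed.

Let carrierP x a : rep a = a -> a \notin carrier x -> c (act a x) = 0.
Proof.
move=> ra; apply: contraNeq => /eqP cx; rewrite mem_undup.
case: constructive_indefinite_description => s /= /(_ a cx)[b bs Hab].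
by apply/mapP; exists b; rewrite // -(rep_eq Hab).
Qed.

Definition orbit_sum x := \sum_(a <- carrier x) c (act a x).

(** [carrier x] comes from an arbitrary choice; any duplicate-free list of representatives covering
    the support gives the same sum. *)
Let orbit_sumE x (s : seq G) : uniq s -> {in s, forall a, rep a = a} ->
  (forall a, rep a = a -> a \notin s -> c (act a x) = 0) ->
  orbit_sum x = \sum_(a <- s) c (act a x).
Proof.
move=> us sr sP; apply: big_uniq_support => //; first exact: undup_uniq.
  by move=> a /carrier_rep; apply: sP.
by move=> a /sr; apply: carrierP.
Qed.

Lemma orbit_sumD x y : orbit_sum (x + y) = orbit_sum x + orbit_sum y.
Proof.
pose s := undup (carrier x ++ carrier y ++ carrier (x + y)).
have sE z : z \in [:: x; y; x + y] -> orbit_sum z = \sum_(a <- s) c (act a z).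
  move=> zin; apply: orbit_sumE => [|a|a ra]; first exact: undup_uniq.
    by rewrite mem_undup !mem_cat => /or3P[]; apply: carrier_rep.
  rewrite mem_undup !mem_cat !negb_or => /and3P[nx ny nxy]; apply: carrierP => //.
  by move: zin; rewrite !inE => /or3P[] /eqP->.
rewrite !sE ?inE ?eqxx ?orbT // -big_split; apply: eq_bigr => a _ /=.
by rewrite actD cD.
Qed.

(** Translation by [a] permutes the cosets. Matching terms differ by the action of an element of [H]
    on the argument of [c], which [cH] makes negligible modulo [I]. *)
Lemma orbit_sum_act a x : I (orbit_sum (act a x) - orbit_sum x).
Proof.
(* The second list is there so that translating [s] by [a] covers the carrier of [x]. *)
pose s := undup (carrier (act a x) ++ [seq rep (b - a) | b <- carrier x]).
have s_rep : {in s, forall b, rep b = b}.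
  move=> b; rewrite mem_undup mem_cat => /orP[/carrier_rep//|/mapP[b' _ ->]].
  exact: rep_rep.
rewrite (@orbit_sumE _ s) ?undup_uniq // => [|b rb]; last first.
  by rewrite mem_undup mem_cat negb_or => /andP[nb _]; apply: carrierP.
rewrite (@orbit_sumE x [seq rep (b + a) | b <- s]).
- rewrite big_map -sumrB; elim/big_ind: _ => // b _.
  rewrite -actA -opprB; apply: IN.
  have -> : rep (b + a) = (rep (b + a) - (b + a)) + (b + a) by rewrite subrK.
  by rewrite actA; apply: cH.
- rewrite map_inj_in_uniq ?undup_uniq // => b b' bs bs' E.
  rewrite -(s_rep b) // -(s_rep b') //; apply: rep_eq.
  have := rep_in (b' + a); rewrite -E => Hb'; have := HN (rep_in (b + a)).
  move/HD => /(_ _ Hb'); congr (H _).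
  by rewrite opprB addrA subrK opprD addrACA subrr addr0.
- by move=> _ /mapP[b _ ->]; apply: rep_rep.
move=> b rb; apply: contraNeq => cb; apply/mapP.
have bx : b \in carrier x by apply: contraNT cb => /carrierP ->.
exists (rep (b - a)); first by rewrite mem_undup mem_cat; apply/orP; right; apply/mapP; exists b.
rewrite -[LHS]rb; apply: rep_eq.
have := HN (rep_in (b - a)); congr (H _).
by rewrite opprB [rep _ + a]addrC opprD addrA.
Qed.

Lemma orbit_sum_concentrated x : (forall a, ~~ H a -> c (act a x) = 0) ->
  I (orbit_sum x - c x).
Proof.
move=> cx; rewrite (@orbit_sumE x [:: rep 0]) //.
- rewrite big_seq1; apply: cH.
  by have := rep_in 0; rewrite subr0.
- by move=> a; rewrite inE => /eqP->; apply: rep_rep.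
move=> a ra; rewrite inE => na; apply: cx; apply: contra na => Ha.
by rewrite -ra (@rep_eq a 0) ?subr0.
Qed.

End OrbitSum.

(** * Differences along a lattice of shifts *)

Section DeltaSpan.
Variables (F : fieldType) (m n : nat).
Notation Q := {fraction {mpoly F[m]}}.
Implicit Types (x y w : Q) (k : 'rV[int]_n).
Variables (S : Q -> Prop) (r : nat) (tau : 'I_r -> 'rV[int]_n).
Hypotheses (S0 : S 0) (SD : forall x y, S x -> S y -> S (x + y)) (SN : forall x, S x -> S (- x)).
Hypothesis (S_shiftf : forall k x, S x -> S (shiftf k x)).

(** The parameter [S] serves two cases: all rational functions, for summability, and those of
    bounded degree in x_1, for the numerators. *)
Definition Delta_span x := exists b : 'I_r -> Q,
  (forall i, S (b i)) /\ x = \sum_(i < r) Delta (tau i) (b i).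

Lemma Delta_span0 : Delta_span 0.
Proof. by exists (fun=> 0); split=> //; rewrite big1 // => i _; rewrite /Delta rmorph0 subrr. Qed.

Lemma Delta_spanD x y : Delta_span x -> Delta_span y -> Delta_span (x + y).
Proof.
move=> [b [Sb ->]] [b' [Sb' ->]]; exists (fun i => b i + b' i); split; first by auto.
rewrite -big_split; apply: eq_bigr => i _ /=.
by rewrite /Delta rmorphD opprD addrACA.
Qed.

Lemma Delta_spanN x : Delta_span x -> Delta_span (- x).
Proof.
move=> [b [Sb ->]]; exists (fun i => - b i); split; first by auto.
by rewrite -sumrN; apply: eq_bigr => i _ /=; rewrite /Delta rmorphN opprD.
Qed.

(** The cocycle identity [Delta (k + l) x = Delta k (shiftf l x) + Delta l x] makes the set of
    admissible shifts a subgroup, and it contains every [tau i]. *)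
Lemma Delta_span_lattice (e : 'I_r -> int) w : S w ->
  Delta_span (Delta (\sum_(i < r) (tau i) *~ (e i)) w).
Proof.
pose K k := forall w, S w -> Delta_span (Delta k w).
have K0 : K 0 by move=> x _; rewrite /Delta shiftf0 subrr; apply: Delta_span0.
have KD k l : K k -> K l -> K (k + l).
  move=> Kk Kl x Sx; have -> : Delta (k + l) x = Delta k (shiftf l x) + Delta l x.
    by rewrite /Delta shiftf_add addrA subrK.
  by apply: Delta_spanD; [apply/Kk/S_shiftf | apply: Kl].
have KN k : K k -> K (- k).
  move=> Kk x Sx; have -> : Delta (- k) x = - Delta k (shiftf (- k) x).
    by rewrite /Delta -shiftf_add subrr shiftf0 opprB.
  by apply/Delta_spanN/Kk/S_shiftf.
have Ktau i : K (tau i).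
  move=> x Sx; exists (fun j => if j == i then x else 0).
  split=> [j|]; first by case: eqP.
  rewrite (bigD1 i) //= eqxx big1 ?addr0 // => j /negPf->.
  by rewrite /Delta rmorph0 subrr.
have Kn k a : K k -> K (k *+ a).
  by move=> Kk; elim: a => [|a IHa]; rewrite ?mulr0n // mulrS; apply: KD.
suff : K (\sum_(i < r) (tau i) *~ (e i)) by apply.
elim/big_ind: _ => // i _; case: (e i) => a; first exact: Kn.
exact/KN/Kn.
Qed.

End DeltaSpan.

Lemma summable_lattice (F : fieldType) (m n : nat) (k : 'rV[int]_n)
  (x : {fraction {mpoly F[m]}}) : summable n (Delta k x).
Proof.
pose e (i : 'I_n) : 'rV[int]_n := delta_mx 0 i.
have [b [_ ->]] : Delta_span (fun=> True) e (Delta k x).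
  have -> : k = \sum_(i < n) (e i) *~ (k 0 i).
    by rewrite [k in LHS]row_sum_delta; apply: eq_bigr => i _; rewrite -scaler_int intz.
  exact: Delta_span_lattice.
by exists b.
Qed.

(** Treats both cases of the convention at once: for trivial G_d the zero vector generates it. *)
Lemma chosen_basis_GdP (F : fieldType) (m n r : nat) (d : {mpoly F[m]})
  (tau : 'I_r -> 'rV[int]_n) : chosen_basis_Gd d tau -> forall k,
  inGd d k <-> exists c : 'I_r -> int, k = \sum_(i < r) (tau i) *~ (c i).
Proof.
move=> [[_ [tauP _]]|[triv [_ tau0]]] k; first exact: tauP.
have sum0 (c : 'I_r -> int) : \sum_(i < r) (tau i) *~ (c i) = 0.
  by rewrite big1 // => i _; rewrite tau0 mul0rz.
split=> [/triv ->|[c ->]]; first by exists (fun=> 0); rewrite sum0.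
by rewrite sum0; apply: inGd0.
Qed.

Lemma chosen_basis_inGd (F : fieldType) (m n r : nat) (d : {mpoly F[m]})
  (tau : 'I_r -> 'rV[int]_n) : chosen_basis_Gd d tau -> forall i, inGd d (tau i).
Proof.
move=> htau i; apply/(chosen_basis_GdP htau); exists (fun l => ((l == i) : nat) : int).
rewrite (bigD1 i) //= eqxx mulr1z big1 ?addr0 // => l /negPf->.
by rewrite mulr0z.
Qed.

(** * The two implications *)

Lemma summable_numerator (F : fieldType) (m n j r : nat) (a : {fraction {mpoly F[m.+1]}})
  (d : {mpoly F[m.+1]}) (tau : 'I_r -> 'rV[int]_n) :
  (0 < j)%N -> prime_elt d -> (0 < degv 0 d)%N -> polyx1_lt (degv 0 d) a ->
  chosen_basis_Gd d tau -> summable n (a / d%:F ^+ j) ->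
  Delta_span (polyx1_lt (degv 0 d)) tau a.
Proof.
move=> j0 dP d1 aW htau [g Dg].
have dF : d%:F != 0 by rewrite tofrac_eq0; case: dP.
have djF : d%:F ^+ j != 0 by rewrite expf_neq0.
pose W := polyx1_lt (m := m.+1) (F := F) (degv 0 d).
pose I := Delta_span W tau.
pose c x := residue dP d1 (x * d%:F ^+ j).
have W0 : W 0 by apply: polyx1_lt0.
have WD x y : W x -> W y -> W (x + y) by apply: polyx1_ltD.
have WN x : W x -> W (- x) by apply: polyx1_ltN.
have WS (k : 'rV[int]_n) x : W x -> W (shiftf k x) by apply: polyx1_lt_shiftf.
have I0 : I 0 by apply: Delta_span0.
have ID x y : I x -> I y -> I (x + y) by apply: Delta_spanD.
have IN x : I x -> I (- x) by apply: Delta_spanN.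
have Iw (k : 'rV[int]_n) w : inGd d k -> W w -> I (Delta k w).
  move=> Gk Ww.
  have [e ->] := proj1 (chosen_basis_GdP htau k) Gk.
  exact: (Delta_span_lattice tau W0 WD WN WS e Ww).
(* G_d as a boolean predicate, as the choice of coset representatives requires. *)
pose H : pred 'rV[int]_n := [pred k | shiftp k d == d].
have HG k : reflect (inGd d k) (H k) by apply: (iffP eqP) => /inGdP.
have H0 : H 0 by apply/HG/inGd0.
have HD k l : H k -> H l -> H (k + l) by move=> /HG Gk /HG Gl; apply/HG/inGd_add.
have HN k : H k -> H (- k) by move=> /HG Gk; apply/HG/inGd_opp.
have cD x y : c (x + y) = c x + c y by rewrite /c mulrDl residueD.
have cH (k : 'rV[int]_n) x : H k -> I (c (shiftf k x) - c x).
  move=> /HG Gk; rewrite /c; have -> : shiftf k x * d%:F ^+ j = shiftf k (x * d%:F ^+ j).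
    by rewrite rmorphM rmorphXn /= Gk.
  by rewrite residue_shiftf //; apply: (Iw _ _ Gk); apply: residue_polyx1_lt.
(* Because j is positive, x d^j is [d] times a regular function and has no constant coefficient. *)
have c_regular x : regular d x -> c x = 0.
  move=> xR; rewrite /c -(prednK j0) exprS mulrCA; apply: residue_dregular.
  by apply: regularM => //; apply/regularX/regular_tofrac.
have c_finite x : exists s : seq 'rV[int]_n,
    forall k, c (shiftf k x) <> 0 -> exists2 l, l \in s & H (k - l).
  have [s sP] := regular_shiftf_finite n dP d1 x; exists s => k cx.
  have [|l ls /HG Gl] := sP k; last by exists l.
  by move/c_regular.
have shD k := rmorphD (@shiftf F m.+1 n k).
pose act (k : 'rV[int]_n) := @shiftf F m.+1 n k.
have actA k l x : act (k + l) x = act k (act l x) by apply: shiftf_add.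
have actD k x y : act k (x + y) = act k x + act k y by apply: rmorphD.
pose Phi := orbit_sum (act := act) (H := H) (c := c) c_finite.
have PhiD x y : Phi (x + y) = Phi x + Phi y := orbit_sumD H0 HD HN actD cD c_finite x y.
have PhiI k x : I (Phi (act k x) - Phi x) :=
  orbit_sum_act H0 HD HN I0 ID IN actA cH c_finite k x.
have PhiC x : (forall k, ~~ H k -> c (act k x) = 0) -> I (Phi x - c x) :=
  @orbit_sum_concentrated _ _ _ _ _ _ H0 HD HN cH c_finite x.
clearbody Phi.
have Phi0 : Phi 0 = 0 by apply: (addrI (Phi 0)); rewrite -PhiD !addr0.
have PhiN x : Phi (- x) = - Phi x by apply: (addrI (Phi x)); rewrite -PhiD !subrr.
have If : I (Phi (a / d%:F ^+ j)).
  rewrite Dg (big_morph Phi PhiD Phi0); elim/big_ind: _ => // i _.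
  by rewrite PhiD PhiN; apply: PhiI.
have ca : c (a / d%:F ^+ j) = a by rewrite /c divfK // residue_id.
(* Writes [a] as Phi(f) - (Phi(f) - c(f)) with f = a / d^j; the first term is in [I] by summability,
   the second because f is concentrated on G_d. *)
rewrite -[a]ca -[c _](subKr (Phi (a / d%:F ^+ j))); apply: ID => //; apply: IN.
apply: PhiC => k nHk; rewrite /act fmorph_div rmorphXn /= shiftf_tofrac.
apply: c_regular; apply: regularM => //; first exact/(regular_polyx1 d1)/WS.
rewrite -exprVn; apply: regularX => //; exists 1, (shiftp k d).
rewrite tofrac1 mul1r; split=> // dk; case/negP: nHk.
by apply/eqP/shiftp_divides_eq => //; rewrite -tofrac_eq0.
Qed.

Theorem theorem1p3 (F : fieldType) (m n : nat)
  (hchar : [pchar F] =i pred0) (hn : (1 <= n)%N) (hnm : (n <= m)%N)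
  (j : nat) (hj : (1 <= j)%N) (a : {fraction {mpoly F[m]}}) (d : {mpoly F[m]})
  (hd : mirreducible d) (hdeg : (0 < degv 0 d)%N)
  (ha : polyx1_lt (degv 0 d) a)
  (r : nat) (tau : 'I_r -> 'rV[int]_n) (htau : chosen_basis_Gd d tau) :
  summable n (a / (d%:F) ^+ j) <->
  exists b : 'I_r -> {fraction {mpoly F[m]}},
    (forall i, polyx1_lt (degv 0 d) (b i)) /\
    a = \sum_(i < r) Delta (tau i) (b i).
Proof.
split=> [fS|[b [_ ->]]].
  (* The case m = 0 contradicts 1 <= n <= m; a successor is needed for x_1 to exist. *)
  case: m => [|m] in hnm a d hd hdeg ha htau fS *; first by move: hn; rewrite leqNgt ltnS hnm.
  exact: (summable_numerator hj (mirreducible_prime hd)).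
rewrite mulr_suml.
have S0 : summable n (0 : {fraction {mpoly F[m]}}).
  by exists (fun=> 0); rewrite big1 // => i _; rewrite /sigma rmorph0 subrr.
have SD (x y : {fraction {mpoly F[m]}}) : summable n x -> summable n y -> summable n (x + y).
  move=> [g ->] [h ->]; exists (fun i => g i + h i).
  by rewrite -big_split; apply: eq_bigr => i _; rewrite /sigma rmorphD opprD addrACA.
elim/big_ind: _ => // i _.
(* [tau i] fixes [d], so dividing by d^j commutes with the difference. *)
have -> : Delta (tau i) (b i) / d%:F ^+ j = Delta (tau i) (b i / d%:F ^+ j).
  by rewrite /Delta fmorph_div rmorphXn /= (chosen_basis_inGd htau i) mulrBl.
exact: summable_lattice.
Qed.
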